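(* Let $X$ be a topological space, $Y$ a normal topological space, and $f:X\to Y$ an injection that is $e^*\theta$-continuous and closed (images of closed sets are closed). Then $X$ is $e^*\theta$-normal.
   Context: For a subset $A$ of a topological space $X$, $cl(A)$ and $int(A)$ denote closure and interior. The $\delta$-closure $cl_\delta(A)$ is the set of points $x\in X$ such that $int(cl(U))\cap A\neq\emptyset$ for every open $U$ containing $x$. $A$ is $e^*$-open if $A\subseteq cl(int(cl_\delta(A)))$; complements of $e^*$-open sets are $e^*$-closed; $e^*\text{-}cl(A)$ is the intersection of all $e^*$-closed sets containing $A$. The $e^*$-$\theta$-closure $e^*\text{-}cl_\theta(A)$ is the set of points $x\in X$ such that $e^*\text{-}cl(U)\cap A\neq\emptyset$ for every $e^*$-open set $U$ containing $x$. $A$ is $e^*$-$\theta$-closed if $A=e^*\text{-}cl_\theta(A)$; complements of $e^*$-$\theta$-closed sets are called $e^*$-$\theta$-open. A function $f:X\to Y$ is $e^*\theta$-continuous if $f^{-1}[V]$ is $e^*$-$\theta$-closed in $X$ for every closed set $V$ of $Y$ (equivalently, $f^{-1}[V]$ is $e^*$-$\theta$-open in $X$ for every open $V$ of $Y$). A space is normal if disjoint closed sets can be separated by disjoint open sets (no $T_1$ assumption). A space is $e^*\theta$-normal if for any pair of disjoint closed sets $F_1$ and $F_2$ there exist disjoint $e^*$-$\theta$-open sets $U_1$ and $U_2$ with $F_1\subseteq U_1$ and $F_2\subseteq U_2$. *)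

(* Defs.v *)
From mathcomp Require Import all_boot all_order.
From mathcomp Require Import boolp classical_sets filter topology.

Set Implicit Arguments.
Unset Strict Implicit.
Unset Printing Implicit Defensive.

Local Open Scope classical_set_scope.

Section estar_sets.
Context {T : topologicalType}.
Implicit Types A U : set T.

Definition delta_closure A : set T :=
  [set x | forall U, open U -> U x -> interior (closure U) `&` A !=set0].

Definition estar_open A := A `<=` closure (interior (delta_closure A)).

Definition estar_closed A := estar_open (~` A).

(* [smallest C A] is the intersection of all the supersets of [A] in [C]; it is
   not assumed here to belong to [C]. *)
Definition estar_closure A : set T := smallest estar_closed A.

Definition estar_theta_closure A : set T :=
  [set x | forall U, estar_open U -> U x -> estar_closure U `&` A !=set0].

Definition estar_theta_closed A := A = estar_theta_closure A.

Definition estar_theta_open A := estar_theta_closed (~` A).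

End estar_sets.

Definition estar_theta_continuous {X Y : topologicalType} (f : X -> Y) :=
  forall V : set Y, closed V -> estar_theta_closed (f @^-1` V).

Definition estar_theta_normal_space (T : topologicalType) :=
  forall F1 F2 : set T, closed F1 -> closed F2 -> F1 `&` F2 = set0 ->
    exists U1 U2 : set T,
      [/\ estar_theta_open U1, estar_theta_open U2, F1 `<=` U1, F2 `<=` U2
        & U1 `&` U2 = set0].

Definition closed_map {X Y : topologicalType} (f : X -> Y) :=
  forall C : set X, closed C -> closed (f @` C).

(* The library's [normal_space] is phrased with closed neighborhoods of closed
   sets; it is the usual separation of disjoint closed sets, without T1. *)
Lemma normal_space_sepP (T : topologicalType) :
  normal_space T <->
  forall F1 F2 : set T, closed F1 -> closed F2 -> F1 `&` F2 = set0 ->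
    exists U1 U2 : set T,
      [/\ open U1, open U2, F1 `<=` U1, F2 `<=` U2 & U1 `&` U2 = set0].
Proof.
split=> [nT F1 F2 cF1 cF2 F120|sepT F cF B].
  have /(nT _ cF1) : set_nbhs F1 (~` F2).
    move=> x F1x; apply: open_nbhs_nbhs; split; first exact: closed_openC.
    by move=> F2x; have : (F1 `&` F2) x by []; rewrite F120.
  case=> V /= F1V VF2; exists (interior V), (~` closure V); split.
  - exact: open_interior.
  - by apply: closed_openC; exact: closed_closure.
  - exact: F1V.
  - by move=> x F2x /VF2.
  - by rewrite -subset0 => x [/interior_subset/subset_closure].
move=> FB; have [] := sepT F (~` interior B) cF.
- by apply: open_closedC; exact: open_interior.
- by rewrite -subset0 => x [/FB Bx]; exact.
move=> U1 [U2 [oU1 oU2 FU1 BU2 U120]]; exists U1 => /=.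
  by move=> x /FU1 U1x; exact: open_nbhs_nbhs.
move=> x clU1x; apply: interior_subset; apply: contrapT => /BU2 U2x.
have [y] := clU1x U2 (open_nbhs_nbhs (conj oU2 U2x)).
by rewrite U120.
Qed.

(* Main.v *)
Require Import Defs.
From mathcomp Require Import all_boot all_order.
From mathcomp Require Import boolp classical_sets filter topology.

Local Open Scope classical_set_scope.

(** The separation is pulled back from [Y]. Since [f] is closed and injective, disjoint closed sets
    of [X] have disjoint closed images; normality of [Y] separates these by disjoint open sets,
    whose preimages are disjoint and, by [estar_theta_open_preimage], [estar_theta_open]. *)

Lemma estar_theta_open_preimage (X Y : topologicalType) (f : X -> Y)
    (V : set Y) :
  estar_theta_continuous f -> open V -> estar_theta_open (f @^-1` V).
Proof.
move=> f_cts oV; rewrite /estar_theta_open preimage_setC.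
exact/f_cts/open_closedC.
Qed.

Theorem theorem13 (X Y : topologicalType) (f : X -> Y)
    (normalY : normal_space Y) (f_inj : injective f)
    (f_cts : estar_theta_continuous f) (f_closed : closed_map f) :
  estar_theta_normal_space X.
Proof.
move=> F1 F2 cF1 cF2 F120.
have fF120 : f @` F1 `&` f @` F2 = set0.
  (* A point common to both images comes from some [x] in [F1] and some [y] in [F2]; injectivity
     identifies them, so [F1] and [F2] would meet. *)
  rewrite -subset0 => _ [[x F1x <-] [y F2y /f_inj yx]]; subst y.
  by have : (F1 `&` F2) x by []; rewrite F120.
have /normal_space_sepP sepY := normalY.
have [V1 [V2 [oV1 oV2 FV1 FV2 V120]]] :=
  sepY _ _ (f_closed _ cF1) (f_closed _ cF2) fF120.
exists (f @^-1` V1), (f @^-1` V2); split.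
- exact: estar_theta_open_preimage.
- exact: estar_theta_open_preimage.
- by move=> x F1x; apply: FV1; exists x.
- by move=> x F2x; apply: FV2; exists x.
- by rewrite -preimage_setI V120 preimage_set0.
Qed.
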